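(* Let $\mathcal{C}$ be a semisimple multiring category over $\Bbbk$ with left duals. Then the following are equivalent: (1) the unit object $1$ is simple, i.e. $\mathcal{C}$ is a ring category; (2) for any non-zero algebra $A$ in $\mathcal{C}$, the functor $-\otimes A:\mathcal{C}\to\mathcal{C}_A$ is separable; (3) for any non-zero coalgebra $C$ in $\mathcal{C}$, the functor $-\otimes C:\mathcal{C}\to\mathcal{C}^C$ is separable; (4) for any non-zero algebra $A$ in $\mathcal{C}$, the functor $-\otimes A:\mathcal{C}\to\mathcal{C}_A$ is faithful; (5) for any non-zero coalgebra $C$ in $\mathcal{C}$, the functor $-\otimes C:\mathcal{C}\to\mathcal{C}^C$ is faithful; (6) for any non-zero algebra $A$ in $\mathcal{C}$, the functor $-\otimes A:\mathcal{C}\to\mathcal{C}_A$ is Maschke; (7) for any non-zero coalgebra $C$ in $\mathcal{C}$, the functor $-\otimes C:\mathcal{C}\to\mathcal{C}^C$ is Maschke; (8) for any non-zero algebra $A$ in $\mathcal{C}$, the functor $-\otimes A:\mathcal{C}\to\mathcal{C}_A$ is dual Maschke; (9) for any non-zero coalgebra $C$ in $\mathcal{C}$, the functor $-\otimes C:\mathcal{C}\to\mathcal{C}^C$ is dual Maschke; (10) for any non-zero algebra $A$ in $\mathcal{C}$, the functor $-\otimes A:\mathcal{C}\to\mathcal{C}_A$ is conservative; (11) for any non-zero coalgebra $C$ in $\mathcal{C}$, the functor $-\otimes C:\mathcal{C}\to\mathcal{C}^C$ is conservative; (12) for any non-zero algebra $A$ in $\mathcal{C}$, its unit $u_A:1\to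 A$ is a monomorphism; (13) for any non-zero coalgebra $C$ in $\mathcal{C}$, its counit $\varepsilon_C:C\to 1$ is an epimorphism; (14) any non-zero algebra morphism $f:1\to A$ in $\mathcal{C}$ is a monomorphism; (15) any non-zero coalgebra morphism $f:C\to 1$ in $\mathcal{C}$ is an epimorphism.
   Context: $\Bbbk$ is an algebraically closed field; monoidal categories are assumed strict, with tensor product $\otimes$ and unit object $1$. A multiring category over $\Bbbk$ is a locally finite (finite-dimensional Hom spaces, all objects of finite length) $\Bbbk$-linear abelian monoidal category with bilinear and biexact tensor product; it is a ring category if in addition $\mathrm{End}_{\mathcal{C}}(1)=\Bbbk$. ''With left duals'' means every object has a left dual. A nonzero object is simple if $0$ and itself are its only subobjects; an abelian category is semisimple if every object is a direct sum of simple objects. For an algebra $(A,m_A,u_A)$ in $\mathcal{C}$, $\mathcal{C}_A$ is the category of right $A$-modules in $\mathcal{C}$, and $-\otimes A:\mathcal{C}\to\mathcal{C}_A$ is $M\mapsto (M\otimes A, M\otimes m_A)$, $f\mapsto f\otimes A$. For a coalgebra $(C,\Delta_C,\varepsilon_C)$ in $\mathcal{C}$, $\mathcal{C}^C$ is the category of right $C$-comodules in $\mathcal{C}$, and $-\otimes C:\mathcal{C}\to\mathcal{C}^C$ is $M\mapsto (M\otimes C, M\otimes\Delta_C)$, $f\mapsto f\otimes C$. A functor $F:\mathcal{C}\to\mathcal{D}$ is separable if there is a natural transformation $\mathcal{P}:\mathrm{Hom}_{\mathcal{D}}(F-,F-)\to\mathrm{Hom}_{\mathcal{C}}(-,-)$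 with $\mathcal{P}(F(f))=f$ for every morphism $f$ in $\mathcal{C}$. $F$ is Maschke if it reflects split-monomorphisms (if $F(i)$ is split-mono then $i$ is split-mono), dual Maschke if it reflects split-epimorphisms, and conservative if it reflects isomorphisms.
   Formalization: The formal statement additionally assumes that the category is non-zero (some object is not a zero object); in the zero category conditions (2)–(15) hold vacuously while the unit object 1 is not simple, so the equivalence fails there. *)

(* Defs.v *)
From HB Require Import structures.
From mathcomp Require Import all_boot all_order all_algebra.
Set Implicit Arguments.
Unset Strict Implicit.
Unset Printing Implicit Defensive.
Import GRing.Theory.
Local Open Scope ring_scope.

Declare Scope cat_scope.
Delimit Scope cat_scope with cat.
Local Open Scope cat_scope.

Record category := Category {
  object :> Type;
  Mor : object -> object -> Type;
  idm : forall X, Mor X X;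
  compose : forall X Y Z, Mor Y Z -> Mor X Y -> Mor X Z;
  compose1m : forall X Y (f : Mor X Y), compose (idm Y) f = f;
  composem1 : forall X Y (f : Mor X Y), compose f (idm X) = f;
  composeA : forall X Y Z W (h : Mor Z W) (g : Mor Y Z) (f : Mor X Y),
    compose h (compose g f) = compose (compose h g) f }.

Arguments Mor {c} X Y.
Arguments idm {c} X.
Arguments compose {c X Y Z} g f.
Notation "g ∘ f" := (compose g f) (at level 40, left associativity) : cat_scope.

Section CategoryNotions.
Variable C : category.
Implicit Types X Y Z : C.

Definition monomorphism X Y (i : Mor X Y) : Prop :=
  forall Z (f g : Mor Z X), i ∘ f = i ∘ g -> f = g.

Definition epimorphism X Y (p : Mor X Y) : Prop :=
  forall Z (f g : Mor Y Z), f ∘ p = g ∘ p -> f = g.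

Definition split_mono X Y (i : Mor X Y) : Prop :=
  exists r : Mor Y X, r ∘ i = idm X.

Definition split_epi X Y (p : Mor X Y) : Prop :=
  exists s : Mor Y X, p ∘ s = idm Y.

Definition is_iso X Y (f : Mor X Y) : Prop :=
  exists g : Mor Y X, g ∘ f = idm X /\ f ∘ g = idm Y.

Definition is_zero X : Prop :=
  forall Y, (exists! f : Mor X Y, True) /\ (exists! f : Mor Y X, True).

Definition simple_object X : Prop :=
  ~ is_zero X /\ forall Y (i : Mor Y X), monomorphism i -> is_zero Y \/ is_iso i.

Definition eq_to_mor X Y (e : X = Y) : Mor X Y :=
  match e in _ = Z return Mor X Z with erefl => idm X end.

End CategoryNotions.

Definition nonzero_category (C : category) : Prop := exists X : C, ~ is_zero X.

Record functor (C D : category) := Functor {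
  fobj :> C -> D;
  fmap : forall X Y : C, Mor X Y -> Mor (fobj X) (fobj Y);
  fmap1 : forall X : C, fmap (idm X) = idm (fobj X);
  fmapM : forall (X Y Z : C) (g : Mor Y Z) (f : Mor X Y),
    fmap (g ∘ f) = fmap g ∘ fmap f }.

Arguments fmap {C D} F {X Y} _ : rename.

Section FunctorNotions.
Variables (C D : category) (F : functor C D).

Definition faithful_functor : Prop :=
  forall (X Y : C) (f g : Mor X Y), fmap F f = fmap F g -> f = g.

Definition separable_functor : Prop :=
  exists P : forall X Y : C, Mor (F X) (F Y) -> Mor X Y,
    (forall (X X' Y Y' : C) (a : Mor X' X) (b : Mor Y Y')
            (h : Mor (F X) (F Y)),
       P X' Y' (fmap F b ∘ h ∘ fmap F a) = b ∘ P X Y h ∘ a) /\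
    (forall (X Y : C) (f : Mor X Y), P X Y (fmap F f) = f).

Definition maschke_functor : Prop :=
  forall (X Y : C) (i : Mor X Y), split_mono (fmap F i) -> split_mono i.

Definition dual_maschke_functor : Prop :=
  forall (X Y : C) (p : Mor X Y), split_epi (fmap F p) -> split_epi p.

Definition conservative_functor : Prop :=
  forall (X Y : C) (f : Mor X Y), is_iso (fmap F f) -> is_iso f.

End FunctorNotions.

(* [vectType k] is the type of finite-dimensional k-vector spaces, so the
   finite-dimensionality of Hom spaces is part of this structure. *)
Record linear_category (k : fieldType) := LinearCategory {
  lobject : Type;
  lmor : lobject -> lobject -> vectType k;
  lidm : forall X, lmor X X;
  lcompose : forall X Y Z, lmor Y Z -> lmor X Y -> lmor X Z;
  lcompose1m : forall X Y (f : lmor X Y), lcompose (lidm Y) f = f;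
  lcomposem1 : forall X Y (f : lmor X Y), lcompose f (lidm X) = f;
  lcomposeA : forall X Y Z W (h : lmor Z W) (g : lmor Y Z) (f : lmor X Y),
    lcompose h (lcompose g f) = lcompose (lcompose h g) f;
  lcompose_linearl : forall X Y Z (f : lmor X Y) (a : k) (g g' : lmor Y Z),
    lcompose (a *: g + g') f = a *: lcompose g f + lcompose g' f;
  lcompose_linearr : forall X Y Z (g : lmor Y Z) (a : k) (f f' : lmor X Y),
    lcompose g (a *: f + f') = a *: lcompose g f + lcompose g f' }.

Coercion lin_cat (k : fieldType) (C : linear_category k) : category :=
  @Category (lobject C) (fun X Y => lmor X Y) (@lidm k C) (@lcompose k C)
    (@lcompose1m k C) (@lcomposem1 k C) (@lcomposeA k C).

Section Abelian.
Variables (k : fieldType) (C : linear_category k).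
Implicit Types X Y Z : C.

Definition nonzero_mor X Y (f : Mor X Y) : Prop := f <> 0 :> lmor _ _.

Definition is_kernel X Y (f : Mor X Y) K (i : Mor K X) : Prop :=
  f ∘ i = 0 :> lmor _ _ /\
  forall Z (g : Mor Z X), f ∘ g = 0 :> lmor _ _ -> exists! h : Mor Z K, i ∘ h = g.

Definition is_cokernel X Y (f : Mor X Y) Q (p : Mor Y Q) : Prop :=
  p ∘ f = 0 :> lmor _ _ /\
  forall Z (g : Mor Y Z), g ∘ f = 0 :> lmor _ _ -> exists! h : Mor Q Z, h ∘ p = g.

Definition short_exact X Y Z (f : Mor X Y) (g : Mor Y Z) : Prop :=
  is_kernel g f /\ is_cokernel f g.

Definition is_direct_sum n (S : 'I_n -> C) X : Prop :=
  exists (i : forall a, Mor (S a) X) (p : forall a, Mor X (S a)),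
    [/\ forall a, p a ∘ i a = idm (S a),
        forall a b, a != b -> p a ∘ i b = 0 :> lmor _ _
      & \sum_(a < n) (i a ∘ p a : lmor X X) = idm X].

(* For n = 0 the first clause gives a zero object. *)
Definition is_abelian : Prop :=
  [/\ forall n (S : 'I_n -> C), exists X, is_direct_sum S X,
      forall X Y (f : Mor X Y), exists K (i : Mor K X), is_kernel f i,
      forall X Y (f : Mor X Y), exists Q (p : Mor Y Q), is_cokernel f p,
      forall X Y (f : Mor X Y), monomorphism f -> exists Z (g : Mor Y Z), is_kernel g f
    & forall X Y (f : Mor X Y), epimorphism f -> exists Z (g : Mor Z X), is_cokernel g f].

Inductive finite_length : C -> Prop :=
| FiniteLength0 X of is_zero X : finite_length X
| FiniteLengthS X' X S (i : Mor X' X) (p : Mor X S)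
    of short_exact i p & simple_object S & finite_length X' : finite_length X.

(* As all objects will have finite length, direct sums are finite. *)
Definition semisimple_category : Prop :=
  forall X, exists n (S : 'I_n -> C),
    (forall a, simple_object (S a)) /\ is_direct_sum S X.

End Abelian.

Record monoidal_structure (C : category) := MonoidalStructure {
  tens : C -> C -> C;
  tensm : forall X X' Y Y' : C,
    Mor X X' -> Mor Y Y' -> Mor (tens X Y) (tens X' Y');
  munit : C;
  assoc : forall X Y Z, Mor (tens (tens X Y) Z) (tens X (tens Y Z));
  associ : forall X Y Z, Mor (tens X (tens Y Z)) (tens (tens X Y) Z);
  lunit : forall X, Mor (tens munit X) X;
  luniti : forall X, Mor X (tens munit X);
  runit : forall X, Mor (tens X munit) X;
  runiti : forall X, Mor X (tens X munit);
  tensm1 : forall X Y, tensm (idm X) (idm Y) = idm (tens X Y);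
  tensmM : forall X X' X'' Y Y' Y'' (f' : Mor X' X'') (f : Mor X X')
      (g' : Mor Y' Y'') (g : Mor Y Y'),
    tensm (f' ∘ f) (g' ∘ g) = tensm f' g' ∘ tensm f g;
  assocK : forall X Y Z, associ X Y Z ∘ assoc X Y Z = idm _;
  associK : forall X Y Z, assoc X Y Z ∘ associ X Y Z = idm _;
  lunitK : forall X, luniti X ∘ lunit X = idm _;
  lunitiK : forall X, lunit X ∘ luniti X = idm _;
  runitK : forall X, runiti X ∘ runit X = idm _;
  runitiK : forall X, runit X ∘ runiti X = idm _;
  assoc_nat : forall X X' Y Y' Z Z' (f : Mor X X') (g : Mor Y Y') (h : Mor Z Z'),
    assoc X' Y' Z' ∘ tensm (tensm f g) h = tensm f (tensm g h) ∘ assoc X Y Z;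
  lunit_nat : forall X Y (f : Mor X Y),
    lunit Y ∘ tensm (idm munit) f = f ∘ lunit X;
  runit_nat : forall X Y (f : Mor X Y),
    runit Y ∘ tensm f (idm munit) = f ∘ runit X;
  pentagon : forall W X Y Z,
    assoc W X (tens Y Z) ∘ assoc (tens W X) Y Z =
    tensm (idm W) (assoc X Y Z) ∘ assoc W (tens X Y) Z
      ∘ tensm (assoc W X Y) (idm Z);
  triangle : forall X Y,
    tensm (idm X) (lunit Y) ∘ assoc X munit Y = tensm (runit X) (idm Y) }.

Arguments tens {C} m X Y.
Arguments tensm {C} m {X X' Y Y'} f g.
Arguments munit {C} m.
Arguments assoc {C} m X Y Z.
Arguments associ {C} m X Y Z.
Arguments lunit {C} m X.
Arguments luniti {C} m X.
Arguments runit {C} m X.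
Arguments runiti {C} m X.

(* The associators and unitors are identities, up to the transport along
   equalities of objects needed to state this. *)
Record strict_monoidal (C : category) (M : monoidal_structure C) : Prop := Strict {
  strict_assoc : forall X Y Z : C,
    exists e : tens M (tens M X Y) Z = tens M X (tens M Y Z),
      assoc M X Y Z = eq_to_mor e;
  strict_lunit : forall X : C,
    exists e : tens M (munit M) X = X, lunit M X = eq_to_mor e;
  strict_runit : forall X : C,
    exists e : tens M X (munit M) = X, runit M X = eq_to_mor e }.

Section Coherence.
Variables (C : category) (M : monoidal_structure C).
Local Notation "X ⊗ Y" := (tens M X Y) (at level 35, right associativity).
Local Notation "f ⊗m g" := (tensm M f g) (at level 35, right associativity).
Local Notation "1" := (munit M).
Local Notation "''id' X" := (idm X) (at level 8, X at level 2, format "''id' X").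
Local Notation α := (assoc M _ _ _).
Local Notation αi := (associ M _ _ _).

Lemma associ_nat (X X' Y Y' Z Z' : C)
    (f : Mor X X') (g : Mor Y Y') (h : Mor Z Z') :
  (f ⊗m g) ⊗m h ∘ αi = αi ∘ f ⊗m (g ⊗m h).
Proof.
rewrite -[LHS]compose1m -(assocK M) -!composeA; congr (_ ∘ _).
by rewrite composeA assoc_nat -composeA associK composem1.
Qed.

Lemma associ_pentagon (W X Y Z : C) :
  assoc M (W ⊗ X) Y Z ∘ associ M W X Y ⊗m 'id Z ∘ associ M W (X ⊗ Y) Z =
  associ M W X (Y ⊗ Z) ∘ 'id W ⊗m assoc M X Y Z.
Proof.
rewrite -[LHS]compose1m -(assocK M) -!composeA; congr (_ ∘ _).
rewrite !composeA pentagon -(composeA _ (assoc M W X Y ⊗m _)) -tensmM associK compose1m.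
by rewrite tensm1 composem1 -composeA associK composem1.
Qed.

Lemma tensm_unit_inj (X Y : C) (f g : Mor X Y) :
  f ⊗m 'id 1 = g ⊗m 'id 1 -> f = g.
Proof.
move=> e; have: runit M Y ∘ (f ⊗m 'id 1) = runit M Y ∘ (g ⊗m 'id 1) by rewrite e.
rewrite !runit_nat => /(congr1 (fun h => h ∘ runiti M X)).
by rewrite -!composeA runitiK !composem1.
Qed.

Lemma unit_tensm_inj (X Y : C) (f g : Mor X Y) :
  'id 1 ⊗m f = 'id 1 ⊗m g -> f = g.
Proof.
move=> e; have: lunit M Y ∘ ('id 1 ⊗m f) = lunit M Y ∘ ('id 1 ⊗m g) by rewrite e.
rewrite !lunit_nat => /(congr1 (fun h => h ∘ luniti M X)).
by rewrite -!composeA lunitiK !composem1.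
Qed.

Lemma tensm_compl (X X' X'' Y : C) (f' : Mor X' X'') (f : Mor X X') :
  (f' ∘ f) ⊗m 'id Y = f' ⊗m 'id Y ∘ f ⊗m 'id Y.
Proof. by rewrite -tensmM compose1m. Qed.

Lemma tensm_compr (X Y Y' Y'' : C) (g' : Mor Y' Y'') (g : Mor Y Y') :
  'id X ⊗m (g' ∘ g) = 'id X ⊗m g' ∘ 'id X ⊗m g.
Proof. by rewrite -tensmM compose1m. Qed.

Lemma runit_tens (X Y : C) :
  runit M (X ⊗ Y) = 'id X ⊗m runit M Y ∘ assoc M X Y 1.
Proof.
apply: tensm_unit_inj; rewrite tensm_compl.
have: 'id X ⊗m ('id Y ⊗m lunit M 1)
        ∘ (assoc M X Y (1 ⊗ 1) ∘ assoc M (X ⊗ Y) 1 1) =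
      'id X ⊗m ('id Y ⊗m lunit M 1)
        ∘ ('id X ⊗m assoc M Y 1 1 ∘ assoc M X (Y ⊗ 1) 1
           ∘ assoc M X Y 1 ⊗m 'id 1) by rewrite pentagon.
rewrite !composeA -assoc_nat tensm1 -composeA triangle -tensm_compr triangle.
rewrite -assoc_nat -composeA => /(congr1 (fun h => αi ∘ h)).
by rewrite !composeA !assocK !compose1m.
Qed.

Lemma lunit_unit : lunit M 1 = runit M 1.
Proof.
have r1 : runit M (1 ⊗ 1) = runit M 1 ⊗m 'id 1.
  have := runit_nat M (runit M 1).
  move=> /(congr1 (fun h => runiti M 1 ∘ h)).
  by rewrite !composeA runitK !compose1m.
apply: unit_tensm_inj.
have: 'id 1 ⊗m lunit M 1 ∘ assoc M 1 1 1 = 'id 1 ⊗m runit M 1 ∘ assoc M 1 1 1.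
  by rewrite triangle -r1 runit_tens.
move=> /(congr1 (fun h => h ∘ αi)).
by rewrite -!composeA !associK !composem1.
Qed.

End Coherence.

Section Algebras.
Variables (C : category) (M : monoidal_structure C).
Local Notation "X ⊗ Y" := (tens M X Y) (at level 35, right associativity).
Local Notation "f ⊗m g" := (tensm M f g) (at level 35, right associativity).
Local Notation "1" := (munit M).
Local Notation "''id' X" := (idm X) (at level 8, X at level 2, format "''id' X").

(* Y is a left dual of X: evaluation Y ⊗ X -> 1, coevaluation 1 -> X ⊗ Y. *)
Definition has_left_dual (X : C) : Prop :=
  exists (Y : C) (ev : Mor (Y ⊗ X) 1) (coev : Mor 1 (X ⊗ Y)),
    runit M X ∘ 'id X ⊗m ev ∘ assoc M X Y X ∘ coev ⊗m 'id X = lunit M X /\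
    lunit M Y ∘ ev ⊗m 'id Y ∘ associ M Y X Y ∘ 'id Y ⊗m coev = runit M Y.

Record algebra := Algebra {
  alg_obj :> C;
  alg_mul : Mor (alg_obj ⊗ alg_obj) alg_obj;
  alg_unit : Mor 1 alg_obj;
  alg_mulA : alg_mul ∘ alg_mul ⊗m 'id alg_obj =
    alg_mul ∘ 'id alg_obj ⊗m alg_mul ∘ assoc M _ _ _;
  alg_mul1m : alg_mul ∘ alg_unit ⊗m 'id alg_obj = lunit M alg_obj;
  alg_mulm1 : alg_mul ∘ 'id alg_obj ⊗m alg_unit = runit M alg_obj }.

Definition is_alg_morphism (A B : algebra) (f : Mor A B) : Prop :=
  f ∘ alg_mul A = alg_mul B ∘ f ⊗m f /\ f ∘ alg_unit A = alg_unit B.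

Record coalgebra := Coalgebra {
  coalg_obj :> C;
  coalg_comul : Mor coalg_obj (coalg_obj ⊗ coalg_obj);
  coalg_counit : Mor coalg_obj 1;
  coalg_comulA : assoc M _ _ _ ∘ coalg_comul ⊗m 'id coalg_obj ∘ coalg_comul =
    'id coalg_obj ⊗m coalg_comul ∘ coalg_comul;
  coalg_counitl :
    lunit M coalg_obj ∘ coalg_counit ⊗m 'id coalg_obj ∘ coalg_comul = 'id _;
  coalg_counitr :
    runit M coalg_obj ∘ 'id coalg_obj ⊗m coalg_counit ∘ coalg_comul = 'id _ }.

Definition is_coalg_morphism (B D : coalgebra) (f : Mor B D) : Prop :=
  coalg_comul D ∘ f = f ⊗m f ∘ coalg_comul B /\
  coalg_counit D ∘ f = coalg_counit B.

Record rmodule (A : algebra) := RModule {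
  mod_obj :> C;
  mod_act : Mor (mod_obj ⊗ A) mod_obj;
  mod_actA : mod_act ∘ mod_act ⊗m 'id A =
    mod_act ∘ 'id mod_obj ⊗m alg_mul A ∘ assoc M _ _ _;
  mod_act1 : mod_act ∘ 'id mod_obj ⊗m alg_unit A = runit M mod_obj }.

Record rcomodule (D : coalgebra) := RComodule {
  comod_obj :> C;
  comod_coact : Mor comod_obj (comod_obj ⊗ D);
  comod_coactA : assoc M _ _ _ ∘ comod_coact ⊗m 'id D ∘ comod_coact =
    'id comod_obj ⊗m coalg_comul D ∘ comod_coact;
  comod_coact1 :
    runit M comod_obj ∘ 'id comod_obj ⊗m coalg_counit D ∘ comod_coact = 'id _ }.

Program Definition unit_algebra : algebra := @Algebra 1 (lunit M 1) ('id 1) _ _ _.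
Next Obligation. by rewrite -composeA triangle lunit_unit. Qed.
Next Obligation. by rewrite tensm1 composem1. Qed.
Next Obligation. by rewrite tensm1 composem1 lunit_unit. Qed.

Program Definition unit_coalgebra : coalgebra :=
  @Coalgebra 1 (luniti M 1) ('id 1) _ _ _.
Next Obligation.
congr (_ ∘ _).
have e : 'id 1 ⊗m luniti M 1 ∘ ('id 1 ⊗m lunit M 1 ∘ assoc M 1 1 1) =
    'id 1 ⊗m luniti M 1 ∘ (lunit M 1 ⊗m 'id 1) by rewrite triangle lunit_unit.
have := congr1 (fun h => h ∘ luniti M 1 ⊗m 'id 1) e.
by rewrite -!composeA -tensm_compl lunitiK tensm1 composem1 !composeA -tensm_compr lunitK
           tensm1 compose1m.
Qed.
Next Obligation. by rewrite tensm1 composem1 lunitiK. Qed.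
Next Obligation. by rewrite tensm1 composem1 -lunit_unit lunitiK. Qed.

Program Definition free_module (A : algebra) (X : C) : rmodule A :=
  @RModule A (X ⊗ A) ('id X ⊗m alg_mul A ∘ assoc M X A A) _ _.
Next Obligation.
move=> A X; rewrite tensm_compl -!composeA.
rewrite [in LHS](composeA (assoc M X A A)) assoc_nat.
rewrite [in RHS](composeA (assoc M X A A)) -tensm1 assoc_nat.
rewrite -!composeA pentagon !composeA -!tensm_compr.
by rewrite -alg_mulA.
Qed.
Next Obligation.
by move=> A X; rewrite -composeA -tensm1 assoc_nat composeA -tensm_compr alg_mulm1 runit_tens.
Qed.

Program Definition free_comodule (D : coalgebra) (X : C) : rcomodule D :=
  @RComodule D (X ⊗ D) (associ M X D D ∘ 'id X ⊗m coalg_comul D) _ _.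
Next Obligation.
move=> D X; rewrite tensm_compl -!composeA (composeA _ (associ M X D D)) associ_nat.
rewrite [RHS]composeA -tensm1 associ_nat -!composeA -!tensm_compr -coalg_comulA.
by rewrite !tensm_compr !composeA -associ_pentagon.
Qed.
Next Obligation.
move=> D X; rewrite runit_tens -(composeA _ (assoc M X D 1)) -tensm1 assoc_nat -!composeA.
by rewrite (composeA (assoc _ _ _ _)) associK compose1m -!tensm_compr composeA coalg_counitr.
Qed.

Lemma free_module_mapP (A : algebra) (X Y : C) (f : Mor X Y) :
  mod_act (free_module A Y) ∘ (f ⊗m 'id A) ⊗m 'id A =
  f ⊗m 'id A ∘ mod_act (free_module A X).
Proof.
rewrite /= -composeA assoc_nat tensm1 !composeA -!tensmM.
by rewrite !compose1m !composem1.
Qed.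

Lemma free_comodule_mapP (D : coalgebra) (X Y : C) (f : Mor X Y) :
  comod_coact (free_comodule D Y) ∘ f ⊗m 'id D =
  (f ⊗m 'id D) ⊗m 'id D ∘ comod_coact (free_comodule D X).
Proof.
rewrite /= [RHS]composeA associ_nat tensm1 -!composeA -!tensmM.
by rewrite !compose1m !composem1.
Qed.

End Algebras.

(* Hom spaces of a linear category have decidable equality, so the (boolean)
   compatibility with the actions makes morphisms of modules a subtype. *)
Section ModuleCategories.
Variables (k : fieldType) (C : linear_category k) (M : monoidal_structure C).
Local Notation "X ⊗ Y" := (tens M X Y) (at level 35, right associativity).
Local Notation "f ⊗m g" := (tensm M f g) (at level 35, right associativity).
Local Notation "''id' X" := (idm X) (at level 8, X at level 2, format "''id' X").

Section Modules.
Variable A : algebra M.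

Definition mod_mor (X Y : rmodule A) : Type :=
  {f : Mor X Y | mod_act Y ∘ f ⊗m 'id A == f ∘ mod_act X :> lmor _ _}.

Program Definition mod_idm (X : rmodule A) : mod_mor X X := exist _ ('id X) _.
Next Obligation. by move=> X; apply/eqP; rewrite tensm1 composem1 compose1m. Qed.

Program Definition mod_comp (X Y Z : rmodule A)
    (g : mod_mor Y Z) (f : mod_mor X Y) : mod_mor X Z :=
  exist _ (val g ∘ val f) _.
Next Obligation.
move=> X Y Z g f; have /eqP hg := valP g; have /eqP hf := valP f; apply/eqP.
by rewrite tensm_compl composeA hg -composeA hf composeA.
Qed.

Program Definition module_category : category :=
  @Category (rmodule A) mod_mor mod_idm mod_comp _ _ _.
Next Obligation. by move=> X Y f; apply: val_inj; exact: compose1m. Qed.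
Next Obligation. by move=> X Y f; apply: val_inj; exact: composem1. Qed.
Next Obligation. by move=> X Y Z W h g f; apply: val_inj; exact: composeA. Qed.

Program Definition free_module_map (X Y : C) (f : Mor X Y) :
    mod_mor (free_module A X) (free_module A Y) := exist _ (f ⊗m 'id A) _.
Next Obligation. by move=> X Y f; apply/eqP; exact: (free_module_mapP A f). Qed.

Program Definition free_module_functor : functor C module_category :=
  @Functor C module_category (free_module A) free_module_map _ _.
Next Obligation. by move=> X; apply: val_inj; exact: tensm1. Qed.
Next Obligation. by move=> X Y Z g f; apply: val_inj; exact: tensm_compl. Qed.

End Modules.

Section Comodules.
Variable D : coalgebra M.

Definition comod_mor (X Y : rcomodule D) : Type :=
  {f : Mor X Y | comod_coact Y ∘ f == f ⊗m 'id D ∘ comod_coact X :> lmor _ _}.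

Program Definition comod_idm (X : rcomodule D) : comod_mor X X :=
  exist _ ('id X) _.
Next Obligation. by move=> X; apply/eqP; rewrite tensm1 composem1 compose1m. Qed.

Program Definition comod_comp (X Y Z : rcomodule D)
    (g : comod_mor Y Z) (f : comod_mor X Y) : comod_mor X Z :=
  exist _ (val g ∘ val f) _.
Next Obligation.
move=> X Y Z g f; have /eqP hg := valP g; have /eqP hf := valP f; apply/eqP.
by rewrite composeA hg -composeA hf composeA -tensm_compl.
Qed.

Program Definition comodule_category : category :=
  @Category (rcomodule D) comod_mor comod_idm comod_comp _ _ _.
Next Obligation. by move=> X Y f; apply: val_inj; exact: compose1m. Qed.
Next Obligation. by move=> X Y f; apply: val_inj; exact: composem1. Qed.
Next Obligation. by move=> X Y Z W h g f; apply: val_inj; exact: composeA. Qed.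

Program Definition free_comodule_map (X Y : C) (f : Mor X Y) :
    comod_mor (free_comodule D X) (free_comodule D Y) := exist _ (f ⊗m 'id D) _.
Next Obligation. by move=> X Y f; apply/eqP; exact: (free_comodule_mapP D f). Qed.

Program Definition free_comodule_functor : functor C comodule_category :=
  @Functor C comodule_category (free_comodule D) free_comodule_map _ _.
Next Obligation. by move=> X; apply: val_inj; exact: tensm1. Qed.
Next Obligation. by move=> X Y Z g f; apply: val_inj; exact: tensm_compl. Qed.

End Comodules.
End ModuleCategories.

(* The zero category is a multiring category in this sense. *)
Record multiring_category (k : fieldType) := MultiringCategory {
  mr_lin :> linear_category k;
  mr_mon :> monoidal_structure mr_lin;
  mr_abelian : is_abelian mr_lin;
  mr_finite_length : forall X : mr_lin, finite_length X;
  mr_bilinearl : forall (X X' Y Y' : mr_lin) (a : k) (f f' : lmor X X')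
      (g : lmor Y Y'),
    tensm mr_mon (a *: f + f' : lmor X X') g =
      a *: (tensm mr_mon f g : lmor _ _) + (tensm mr_mon f' g : lmor _ _);
  mr_bilinearr : forall (X X' Y Y' : mr_lin) (a : k) (f : lmor X X')
      (g g' : lmor Y Y'),
    tensm mr_mon f (a *: g + g' : lmor Y Y') =
      a *: (tensm mr_mon f g : lmor _ _) + (tensm mr_mon f g' : lmor _ _);
  mr_exactr : forall (X Y Y' Y'' : mr_lin) (f : Mor Y Y') (g : Mor Y' Y''),
    short_exact f g ->
    short_exact (tensm mr_mon (idm X) f) (tensm mr_mon (idm X) g);
  mr_exactl : forall (X Y Y' Y'' : mr_lin) (f : Mor Y Y') (g : Mor Y' Y''),
    short_exact f g ->
    short_exact (tensm mr_mon f (idm X)) (tensm mr_mon g (idm X)) }.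

Definition is_ring_category (k : fieldType) (C : multiring_category k) : Prop :=
  bijective (fun a : k => a *: (idm (munit C) : lmor (munit C) (munit C))).

Definition left_duals (k : fieldType) (C : multiring_category k) : Prop :=
  forall X : C, has_left_dual C X.

(* Main.v *)
Require Import Defs.
From HB Require Import structures.
From mathcomp Require Import all_boot all_order all_algebra.
Set Implicit Arguments.
Unset Strict Implicit.
Unset Printing Implicit Defensive.
Import GRing.Theory.
Local Open Scope ring_scope.
Local Open Scope cat_scope.

(** Everything is controlled by the simple direct summands of the unit object.

    Suppose that S is a retract of 1, with inclusion i : S -> 1, projection
    p : 1 -> S and p ∘ i = id, and let e := i ∘ p be the corresponding
    idempotent endomorphism of 1.  Endomorphisms of 1 slide freely from one
    tensor factor to the other and through the unitors, because the left and
    right unitors of 1 agree.  Hence S inherits the algebra and coalgebra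
    structures of 1, with unit p and counit i ([retract_algebra],
    [retract_coalgebra]), and e ⊗ S is the identity ([tens_unit_retract]): both
    free functors attached to S identify e with the identity of 1.  A functor
    that does so while being faithful, Maschke, dual Maschke, conservative or
    separable forces e = id; so does p being a monomorphism or i being an
    epimorphism.  Since the unit object is nonzero, semisimplicity
    provides such an S which is simple, and e = id then identifies 1 with S.
    Thus each of the conditions on algebras or coalgebras, applied to that
    single S, makes 1 simple.

    Conversely, let 1 be simple.  The unit of a nonzero algebra is a nonzero
    morphism out of a simple object, so by Schur's lemma on the summands of the
    target it is a split monomorphism ([nonzero_from_simple_split]); dually the
    counit of a nonzero coalgebra is a split epimorphism.  Inserting the
    splitting transfers morphisms X ⊗ A -> Y ⊗ A back to morphisms X -> Y
    ([transfer]), which is separability of the free functor, and separable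
    functors have all the other properties.

    Finally, a simple unit has only scalar endomorphisms: Schur's lemma and the
    existence of eigenvalues over an algebraically closed field.  When all
    endomorphisms of 1 are scalars, the idempotent e, being nonzero, must be
    the identity, so that 1 is again the simple object S. *)

(** * Functors that identify a retraction idempotent with the identity *)

Lemma split_mono_mono (C : category) (X Y : C) (i : Mor X Y) :
  split_mono i -> monomorphism i.
Proof.
move=> [r ri] Z f g /(congr1 (compose r)).
by rewrite !composeA ri !compose1m.
Qed.

Lemma split_epi_epi (C : category) (X Y : C) (p : Mor X Y) :
  split_epi p -> epimorphism p.
Proof.
move=> [s ps] Z f g /(congr1 (fun h => h ∘ s)).
by rewrite -!composeA ps !composem1.
Qed.

Section Separable.
Variables (C D : category) (F : functor C D).
Hypothesis F_sep : separable_functor F.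

Lemma separable_faithful : faithful_functor F.
Proof. by case: F_sep => P [_ PF] X Y f g /(congr1 (P X Y)); rewrite !PF. Qed.

(** Naturality of P makes P g a one-sided inverse of f on whichever side g is a
    one-sided inverse of F f: compare P (g ∘ F f) with P (F id). *)
Lemma separable_lift_inverse (X Y : C) (f : Mor X Y) (g : Mor (F Y) (F X)) :
  exists h : Mor Y X,
    (g ∘ fmap F f = idm (F X) -> h ∘ f = idm X) /\
    (fmap F f ∘ g = idm (F Y) -> f ∘ h = idm Y).
Proof.
have [P [Pnat PF]] := F_sep; exists (P _ _ g); split=> fg.
  have := Pnat _ _ _ _ f (idm X) g.
  by rewrite fmap1 compose1m fg -fmap1 PF compose1m.
have := Pnat _ _ _ _ (idm Y) f g.
by rewrite fmap1 composem1 fg -fmap1 PF composem1.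
Qed.

Lemma separable_maschke : maschke_functor F.
Proof.
by move=> X Y f [g gf]; have [h [hf _]] := separable_lift_inverse f g; exists h; auto.
Qed.

Lemma separable_dual_maschke : dual_maschke_functor F.
Proof.
by move=> X Y f [g fg]; have [h [_ fh]] := separable_lift_inverse f g; exists h; auto.
Qed.

Lemma separable_conservative : conservative_functor F.
Proof.
by move=> X Y f [g [gf fg]]; have [h [hf fh]] := separable_lift_inverse f g; exists h; auto.
Qed.

End Separable.

(** If p is a monomorphism it cancels from p ∘ (i ∘ p) = p, and if i is an
    epimorphism it cancels from (i ∘ p) ∘ i = i.  A functor with F (i ∘ p) = id
    makes F i and F p mutually inverse, so reflecting the invertibility of
    either one leads to one of these two cases. *)
Section Retracts.
Variables (C : category) (S X : C) (i : Mor S X) (p : Mor X S).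
Hypothesis pi1 : p ∘ i = idm S.

Lemma retract_id_of_mono : monomorphism p -> i ∘ p = idm X.
Proof. by apply; rewrite composeA pi1 compose1m composem1. Qed.

Lemma retract_id_of_epi : epimorphism i -> i ∘ p = idm X.
Proof. by apply; rewrite -composeA pi1 compose1m composem1. Qed.

Variables (D : category) (F : functor C D).
Hypothesis Fip : fmap F (i ∘ p) = idm (F X).

Lemma retract_id_of_faithful : faithful_functor F -> i ∘ p = idm X.
Proof. by apply; rewrite fmap1. Qed.

Lemma retract_id_of_maschke : maschke_functor F -> i ∘ p = idm X.
Proof.
move=> maschkeF; apply/retract_id_of_mono/split_mono_mono/maschkeF.
by exists (fmap F i); rewrite -fmapM.
Qed.

Lemma retract_id_of_dual_maschke : dual_maschke_functor F -> i ∘ p = idm X.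
Proof.
move=> maschkeF; apply/retract_id_of_epi/split_epi_epi/maschkeF.
by exists (fmap F p); rewrite -fmapM.
Qed.

Lemma retract_id_of_conservative : conservative_functor F -> i ∘ p = idm X.
Proof.
move=> /(_ _ _ p) [|q [qp _]].
  by exists (fmap F i); split; rewrite -fmapM // pi1 fmap1.
by apply: retract_id_of_mono; apply: split_mono_mono; exists q.
Qed.

Lemma retract_id_of_separable : separable_functor F -> i ∘ p = idm X.
Proof. by move/separable_faithful; exact: retract_id_of_faithful. Qed.

End Retracts.

(** * Retracts of the unit object *)

Section UnitEndomorphisms.
Variables (C : category) (M : monoidal_structure C).
Local Notation "X ⊗ Y" := (tens M X Y) (at level 35, right associativity).
Local Notation "f ⊗m g" := (tensm M f g) (at level 35, right associativity).
Local Notation "1" := (munit M).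
Local Notation "''id' X" := (idm X) (at level 8, X at level 2, format "''id' X").

Lemma tensm_interchange (X X' Y Y' : C) (f : Mor X X') (g : Mor Y Y') :
  'id X' ⊗m g ∘ f ⊗m 'id Y = f ⊗m g.
Proof. by rewrite -tensmM compose1m composem1. Qed.

Lemma tensm_interchangeC (X X' Y Y' : C) (f : Mor X X') (g : Mor Y Y') :
  f ⊗m 'id Y' ∘ 'id X ⊗m g = f ⊗m g.
Proof. by rewrite -tensmM compose1m composem1. Qed.

(** Uses that the two unitors of the unit object coincide: the left unitor
    is natural in the second factor, the right one in the first. *)
Lemma lunit_endol (e : Mor 1 1) : lunit M 1 ∘ e ⊗m 'id 1 = e ∘ lunit M 1.
Proof. by rewrite lunit_unit runit_nat. Qed.

Lemma unit_endo_tensC (e : Mor 1 1) : e ⊗m 'id 1 = 'id 1 ⊗m e.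
Proof.
apply: (split_mono_mono (i := lunit M 1)).
  by exists (luniti M 1); rewrite lunitK.
by rewrite lunit_endol lunit_nat.
Qed.

Lemma luniti_nat (X Y : C) (f : Mor X Y) :
  'id 1 ⊗m f ∘ luniti M X = luniti M Y ∘ f.
Proof.
apply: (split_mono_mono (i := lunit M Y)).
  by exists (luniti M Y); rewrite lunitK.
by rewrite composeA lunit_nat !composeA lunitiK compose1m -composeA lunitiK composem1.
Qed.

Lemma runiti_nat (X Y : C) (f : Mor X Y) :
  f ⊗m 'id 1 ∘ runiti M X = runiti M Y ∘ f.
Proof.
apply: (split_mono_mono (i := runit M Y)).
  by exists (runiti M Y); rewrite runitK.
by rewrite composeA runit_nat !composeA runitiK compose1m -composeA runitiK composem1.
Qed.

Lemma alg_unit_is_alg_morphism (A : algebra M) :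
  is_alg_morphism (A := unit_algebra M) (alg_unit A).
Proof.
split; last exact: composem1.
by rewrite /= -tensm_interchangeC composeA alg_mul1m lunit_nat.
Qed.

Lemma coalg_counit_is_coalg_morphism (D : coalgebra M) :
  is_coalg_morphism (D := unit_coalgebra M) (coalg_counit D).
Proof.
split; last exact: compose1m.
have unitD : coalg_counit D ⊗m 'id D ∘ coalg_comul D = luniti M D.
  by rewrite -[LHS]compose1m -lunitK -composeA (composeA (lunit M _)) coalg_counitl
             composem1.
by rewrite /= -tensm_interchange -composeA unitD luniti_nat.
Qed.

End UnitEndomorphisms.

Section UnitRetracts.
Variables (C : category) (M : monoidal_structure C).
Local Notation "X ⊗ Y" := (tens M X Y) (at level 35, right associativity).
Local Notation "f ⊗m g" := (tensm M f g) (at level 35, right associativity).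
Local Notation "1" := (munit M).
Local Notation "''id' X" := (idm X) (at level 8, X at level 2, format "''id' X").

Variables (S : C) (i : Mor S 1) (p : Mor 1 S).
Hypothesis pi1 : p ∘ i = 'id S.

(** On 1 ⊗ S the idempotent i ∘ p may be moved from 1 to the second factor,
    where it stands between p and i and p ∘ i ∘ p ∘ i = id. *)
Lemma tens_unit_retract : (i ∘ p) ⊗m 'id S = 'id (1 ⊗ S).
Proof.
have -> : (i ∘ p) ⊗m 'id S = 'id 1 ⊗m p ∘ (i ∘ p) ⊗m 'id 1 ∘ 'id 1 ⊗m i.
  by rewrite -!tensmM !compose1m !composem1 pi1.
by rewrite unit_endo_tensC -!tensmM !compose1m composeA pi1 compose1m pi1 tensm1.
Qed.

(** The idempotent i ∘ p slides out of either factor through the unitor and is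
    absorbed by p; this reduces the algebra axioms of S to those of 1. *)
Lemma lunit_retract (X Y : C) (f : Mor X 1) (g : Mor Y 1) :
  p ∘ lunit M 1 ∘ (i ∘ p ∘ f) ⊗m g = p ∘ lunit M 1 ∘ f ⊗m g.
Proof.
rewrite -[g in LHS]compose1m tensmM -!composeA (composeA (lunit M 1)).
by rewrite lunit_endol !composeA pi1 compose1m.
Qed.

Lemma lunit_retractr (X Y : C) (f : Mor X 1) (g : Mor Y 1) :
  p ∘ lunit M 1 ∘ f ⊗m (i ∘ p ∘ g) = p ∘ lunit M 1 ∘ f ⊗m g.
Proof.
rewrite -[f in LHS]compose1m tensmM -!composeA (composeA (lunit M 1)).
by rewrite lunit_nat !composeA pi1 compose1m.
Qed.

Lemma retract_mulA : let m := p ∘ lunit M 1 ∘ i ⊗m i in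
  m ∘ m ⊗m 'id S = m ∘ 'id S ⊗m m ∘ assoc M _ _ _.
Proof.
move=> m; pose x := lunit M 1 ∘ i ⊗m i.
have ml : m ∘ m ⊗m 'id S = p ∘ lunit M 1 ∘ x ⊗m i.
  by rewrite -lunit_retract /m -(composeA (p ∘ lunit M 1)) -tensmM composem1 /x !composeA.
have mr : m ∘ 'id S ⊗m m = p ∘ lunit M 1 ∘ i ⊗m x.
  by rewrite -lunit_retractr /m -(composeA (p ∘ lunit M 1)) -tensmM composem1 /x !composeA.
rewrite ml mr -[i in x ⊗m i]compose1m -[i in i ⊗m x]compose1m.
rewrite !tensmM -!composeA -assoc_nat !composeA.
by have /= := alg_mulA (unit_algebra M); rewrite -!(composeA p) => ->.
Qed.

Lemma retract_mul1m : p ∘ lunit M 1 ∘ i ⊗m i ∘ p ⊗m 'id S = lunit M S.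
Proof.
rewrite -composeA -tensmM composem1 -[i ∘ p]composem1 lunit_retract.
by rewrite -composeA lunit_nat composeA pi1 compose1m.
Qed.

Lemma retract_mulm1 : p ∘ lunit M 1 ∘ i ⊗m i ∘ 'id S ⊗m p = runit M S.
Proof.
rewrite -composeA -tensmM composem1 -[i ∘ p]composem1 lunit_retractr.
by rewrite lunit_unit -composeA runit_nat composeA pi1 compose1m.
Qed.

Definition retract_algebra : algebra M :=
  Algebra retract_mulA retract_mul1m retract_mulm1.

(** The mirror image of [lunit_retract], for the coalgebra axioms. *)
Lemma luniti_retract (X Y : C) (f : Mor 1 X) (g : Mor 1 Y) :
  (f ∘ (i ∘ p)) ⊗m g ∘ (luniti M 1 ∘ i) = f ⊗m g ∘ (luniti M 1 ∘ i).
Proof.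
rewrite -[g in LHS]composem1 tensmM unit_endo_tensC -!composeA.
by rewrite (composeA _ (luniti M 1)) luniti_nat -!composeA pi1 composem1.
Qed.

Lemma luniti_retractr (X Y : C) (f : Mor 1 X) (g : Mor 1 Y) :
  f ⊗m (g ∘ (i ∘ p)) ∘ (luniti M 1 ∘ i) = f ⊗m g ∘ (luniti M 1 ∘ i).
Proof.
rewrite -[f in LHS]composem1 tensmM -!composeA.
by rewrite (composeA _ (luniti M 1)) luniti_nat -!composeA pi1 composem1.
Qed.

Lemma retract_comulA : let d := p ⊗m p ∘ (luniti M 1 ∘ i) in
  assoc M _ _ _ ∘ d ⊗m 'id S ∘ d = 'id S ⊗m d ∘ d.
Proof.
move=> d; pose x := p ⊗m p ∘ luniti M 1.
have dl : d ⊗m 'id S ∘ d = x ⊗m p ∘ (luniti M 1 ∘ i).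
  by rewrite -luniti_retract /d (composeA _ (p ⊗m p)) -tensmM compose1m /x !composeA.
have dr : 'id S ⊗m d ∘ d = p ⊗m x ∘ (luniti M 1 ∘ i).
  by rewrite -luniti_retractr /d (composeA _ (p ⊗m p)) -tensmM compose1m /x !composeA.
rewrite dr -composeA dl -[p in x ⊗m p]composem1 -[p in p ⊗m x]composem1.
rewrite !tensmM !composeA assoc_nat; congr (_ ∘ _); rewrite -!composeA.
by have /= := coalg_comulA (unit_coalgebra M); rewrite -!composeA => ->.
Qed.

Lemma retract_counitl :
  lunit M S ∘ i ⊗m 'id S ∘ (p ⊗m p ∘ (luniti M 1 ∘ i)) = 'id S.
Proof.
rewrite -composeA (composeA _ (p ⊗m p)) -tensmM compose1m -[i ∘ p]compose1m.
rewrite luniti_retract (composeA _ (luniti M 1)) luniti_nat !composeA.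
by rewrite lunitiK compose1m.
Qed.

Lemma retract_counitr :
  runit M S ∘ 'id S ⊗m i ∘ (p ⊗m p ∘ (luniti M 1 ∘ i)) = 'id S.
Proof.
rewrite -composeA (composeA _ (p ⊗m p)) -tensmM compose1m -[i ∘ p]compose1m.
by rewrite luniti_retractr !composeA runit_nat -(composeA p) -lunit_unit lunitiK composem1.
Qed.

Definition retract_coalgebra : coalgebra M :=
  Coalgebra retract_comulA retract_counitl retract_counitr.

End UnitRetracts.

Section LinearRetracts.
Variables (k : fieldType) (C : linear_category k) (M : monoidal_structure C).
Local Notation "1" := (munit M).
Variables (S : C) (i : Mor S 1) (p : Mor 1 S).
Hypothesis pi1 : p ∘ i = idm S.

Lemma free_module_retract : let F := free_module_functor (retract_algebra pi1) in
  fmap F (i ∘ p) = idm (F 1).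
Proof. by apply: val_inj; exact: tens_unit_retract. Qed.

Lemma free_comodule_retract :
  let F := free_comodule_functor (retract_coalgebra pi1) in
  fmap F (i ∘ p) = idm (F 1).
Proof. by apply: val_inj; exact: tens_unit_retract. Qed.

End LinearRetracts.

(** * Split units give separable free functors *)

(** The retraction r of u turns a morphism of free objects back into a morphism
    of C, and the same formula serves algebras (u the unit, r a retraction of
    it) and coalgebras (r the counit, u a section of it). *)
Section Transfer.
Variables (C : category) (M : monoidal_structure C).
Variables (A : C) (u : Mor (munit M) A) (r : Mor A (munit M)).
Local Notation "X ⊗ Y" := (tens M X Y) (at level 35, right associativity).
Local Notation "f ⊗m g" := (tensm M f g) (at level 35, right associativity).
Local Notation "''id' X" := (idm X) (at level 8, X at level 2, format "''id' X").

Definition transfer (X Y : C) (h : Mor (X ⊗ A) (Y ⊗ A)) : Mor X Y :=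
  runit M Y ∘ 'id Y ⊗m r ∘ h ∘ 'id X ⊗m u ∘ runiti M X.

Lemma transfer_nat (X X' Y Y' : C) (a : Mor X' X) (b : Mor Y Y')
    (h : Mor (X ⊗ A) (Y ⊗ A)) :
  transfer (b ⊗m 'id A ∘ h ∘ a ⊗m 'id A) = b ∘ transfer h ∘ a.
Proof.
have ra : a ⊗m 'id A ∘ 'id X' ⊗m u ∘ runiti M X' = 'id X ⊗m u ∘ runiti M X ∘ a.
  by rewrite tensm_interchangeC -tensm_interchange -!composeA runiti_nat.
have lb : runit M Y' ∘ 'id Y' ⊗m r ∘ b ⊗m 'id A = b ∘ runit M Y ∘ 'id Y ⊗m r.
  by rewrite -composeA tensm_interchange -tensm_interchangeC composeA runit_nat.
by rewrite /transfer !composeA lb -!composeA (composeA (a ⊗m _)) ra !composeA.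
Qed.

Lemma transferK (X Y : C) (f : Mor X Y) :
  r ∘ u = 'id (munit M) -> transfer (f ⊗m 'id A) = f.
Proof.
move=> ru; rewrite /transfer -(composeA _ (f ⊗m _)) tensm_interchangeC.
rewrite -(composeA _ (_ ⊗m r)) -tensmM ru compose1m.
by rewrite -composeA runiti_nat composeA runitiK compose1m.
Qed.

End Transfer.

Section SplitUnits.
Variables (k : fieldType) (C : linear_category k) (M : monoidal_structure C).

Lemma split_unit_separable (A : algebra M) :
  split_mono (alg_unit A) -> separable_functor (free_module_functor A).
Proof.
move=> [r ru]; exists (fun X Y h => transfer (alg_unit A) r (val h)).
by split=> [X X' Y Y' a b h | X Y f]; [exact: transfer_nat | exact: transferK].
Qed.

Lemma split_counit_separable (D : coalgebra M) :
  split_epi (coalg_counit D) -> separable_functor (free_comodule_functor D).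
Proof.
move=> [s es]; exists (fun X Y h => transfer s (coalg_counit D) (val h)).
by split=> [X X' Y Y' a b h | X Y f]; [exact: transfer_nat | exact: transferK].
Qed.

End SplitUnits.

(** * Simple objects in linear categories *)

(** The nonzero vector v0 excludes dimension 0, in which the characteristic
    polynomial is 1 and has no root. *)
Lemma closed_eigenvector (k : closedFieldType) (V : vectType k) (f : 'End(V)) (v0 : V) :
  v0 != 0 -> exists a : k, exists2 v : V, v != 0 & f v = a *: v.
Proof.
move=> v0_neq0; pose e := vbasis {:V}; have eV : basis_of {:V} e := vbasisP _.
pose A := passmx.mxof e e f.
have size_p : size (char_poly A) != 1%N.
  rewrite size_char_poly eqSS dimv_eq0; apply: contraNneq v0_neq0 => V0.
  by rewrite -memv0 -V0 memvf.
have [a] := closed_rootP _ size_p; rewrite -eigenvalue_root_char /eigenvalue.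
rewrite -(passmx.vsof_eq0 eV) -passmx.leigenspaceE // -vpick0 => v_neq0.
exists a, (vpick (passmx.leigenspace f a)) => //.
have := memv_pick (passmx.leigenspace f a); rewrite memv_ker !lfunE /= lfunE /= subr_eq0.
by rewrite lfunE /= id_lfunE => /eqP.
Qed.

Definition has_kernels (k : fieldType) (C : linear_category k) : Prop :=
  forall (X Y : C) (f : Mor X Y), exists (K : C) (i : Mor K X), is_kernel f i.

Section Linear.
Variables (k : fieldType) (C : linear_category k).
Implicit Types X Y Z : C.

Lemma lcomp0m X Y Z (f : Mor X Y) : ((0 : lmor Y Z) : Mor Y Z) ∘ f = 0 :> lmor X Z.
Proof.
have := lcompose_linearl f (-1) (0 : lmor Y Z) 0.
by rewrite scaler0 addr0 scaleN1r addNr.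
Qed.

Lemma lcompm0 X Y Z (g : Mor Y Z) : g ∘ ((0 : lmor X Y) : Mor X Y) = 0 :> lmor X Z.
Proof.
have := lcompose_linearr g (-1) (0 : lmor X Y) 0.
by rewrite scaler0 addr0 scaleN1r addNr.
Qed.

Lemma lcompmZD X Y Z (g : Mor Y Z) (a : k) (f f' : lmor X Y) :
  g ∘ (a *: f + f' : Mor X Y) =
    a *: (g ∘ f : lmor _ _) + (g ∘ f' : lmor _ _) :> lmor X Z.
Proof. exact: lcompose_linearr. Qed.

Lemma lcompmZ X Y Z (g : Mor Y Z) (a : k) (f : lmor X Y) :
  g ∘ (a *: f : Mor X Y) = a *: (g ∘ (f : Mor X Y) : lmor _ _) :> lmor X Z.
Proof. by have := lcompmZD g a f 0; rewrite lcompm0 !addr0. Qed.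

Lemma lcompZDm X Y Z (f : Mor X Y) (a : k) (g g' : lmor Y Z) :
  (a *: g + g' : Mor Y Z) ∘ f =
    a *: ((g : Mor Y Z) ∘ f : lmor _ _) + ((g' : Mor Y Z) ∘ f : lmor _ _) :> lmor X Z.
Proof. exact: lcompose_linearl. Qed.

Lemma lcomp_suml X Y Z (f : Mor X Y) n (F : 'I_n -> lmor Y Z) :
  (\sum_(a < n) F a : Mor Y Z) ∘ f =
    \sum_(a < n) ((F a : Mor Y Z) ∘ f : lmor _ _) :> lmor X Z.
Proof.
apply: (big_morph (fun g : lmor Y Z => (g : Mor Y Z) ∘ f : lmor X Z)); last exact: lcomp0m.
by move=> g g'; rewrite -[g]scale1r lcompZDm !scale1r.
Qed.

Lemma lcomp_sumr X Y Z (g : Mor Y Z) n (F : 'I_n -> lmor X Y) :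
  g ∘ (\sum_(a < n) F a : Mor X Y) = \sum_(a < n) (g ∘ F a : lmor _ _) :> lmor X Z.
Proof.
apply: (big_morph (fun f : lmor X Y => g ∘ (f : Mor X Y) : lmor X Z)); last exact: lcompm0.
by move=> f f'; rewrite -[f]scale1r lcompmZD !scale1r.
Qed.

Lemma is_zeroP X : is_zero X <-> idm X = 0 :> lmor X X.
Proof.
split=> [/(_ X)[[f [_ fP]] _]|X0 Y].
  by rewrite -[LHS]fP // -[RHS]fP.
split; exists 0; split=> // f _.
  by rewrite -[f]composem1 X0 lcompm0.
by rewrite -[f]compose1m X0 lcomp0m.
Qed.

Hypothesis kernels : has_kernels C.

(** The kernel of f is a subobject of X; it is not all of X since f is nonzero,
    hence it vanishes and f is a monomorphism, that is, X is a
    nonzero subobject of Y, hence all of Y. *)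
Lemma schur X Y (f : Mor X Y) :
  simple_object X -> simple_object Y -> nonzero_mor f -> is_iso f.
Proof.
move=> [X_neq0 simpleX] [_ simpleY] f_neq0.
have [K [i [fi0 kerP]]] := kernels f.
have i_mono : monomorphism i.
  move=> Z a b iab; have fia0 : f ∘ (i ∘ a) = 0 :> lmor _ _.
    by rewrite composeA fi0 lcomp0m.
  by have [c [_ cP]] := kerP _ _ fia0; rewrite -[LHS]cP // -[RHS]cP.
have [/is_zeroP K0|[j [_ ij]]] := simpleX _ _ i_mono; last first.
  by case: f_neq0; rewrite -[f]composem1 -ij composeA fi0 lcomp0m.
have f_mono : monomorphism f.
  move=> Z a b fab.
  have fab0 : f ∘ ((-1) *: (b : lmor _ _) + (a : lmor _ _) : Mor Z X) = 0 :> lmor _ _.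
    by rewrite lcompmZD fab scaleN1r addNr.
  have [c [ic _]] := kerP _ _ fab0; apply/eqP; rewrite -subr_eq0 addrC -scaleN1r -ic.
  by rewrite -[i]composem1 K0 lcompm0 lcomp0m.
by have [//|] := simpleY _ _ f_mono; last by [].
Qed.

(** Some component X -> S_a of f is nonzero, hence an isomorphism. *)
Lemma nonzero_from_simple_split X Y (f : Mor X Y) :
  semisimple_category C -> simple_object X -> nonzero_mor f -> split_mono f.
Proof.
move=> semisimpleC simpleX f_neq0.
have [n [S [simpleS [i [p [_ _ sum_ip]]]]]] := semisimpleC Y.
have [a /eqP pf_neq0|pf0] := @pickP _ (fun a => p a ∘ f != 0 :> lmor _ _).
  have [g [gpf _]] := schur simpleX (simpleS a) pf_neq0.
  by exists (g ∘ p a); rewrite -composeA.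
case: f_neq0; rewrite -[f]compose1m -sum_ip lcomp_suml big1 // => a _.
by rewrite -composeA (eqP (negbFE (pf0 a))) lcompm0.
Qed.

(** Some component S_a -> X of f is nonzero, hence an isomorphism. *)
Lemma nonzero_to_simple_split X Y (f : Mor Y X) :
  semisimple_category C -> simple_object X -> nonzero_mor f -> split_epi f.
Proof.
move=> semisimpleC simpleX f_neq0.
have [n [S [simpleS [i [p [_ _ sum_ip]]]]]] := semisimpleC Y.
have [a /eqP fi_neq0|fi0] := @pickP _ (fun a => f ∘ i a != 0 :> lmor _ _).
  have [g [_ fig]] := schur (simpleS a) simpleX fi_neq0.
  by exists (i a ∘ g); rewrite composeA.
case: f_neq0; rewrite -[f]composem1 -sum_ip lcomp_sumr big1 // => a _.
by rewrite composeA (eqP (negbFE (fi0 a))) lcomp0m.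
Qed.

Lemma simple_retract X :
  semisimple_category C -> ~ is_zero X ->
  exists (S : C) (i : Mor S X) (p : Mor X S), simple_object S /\ p ∘ i = idm S.
Proof.
move=> semisimpleC X_neq0; have [n [S [simpleS [i [p [pi1 _ sum_ip]]]]]] := semisimpleC X.
case: n S simpleS i p pi1 sum_ip => [|n] S simpleS i p pi1 sum_ip.
  by case: X_neq0; apply/is_zeroP; rewrite -sum_ip big_ord0.
by exists (S ord0), (i ord0), (p ord0).
Qed.

Lemma simple_of_iso X S (i : Mor S X) (p : Mor X S) :
  simple_object S -> p ∘ i = idm S -> i ∘ p = idm X -> simple_object X.
Proof.
move=> [S_neq0 simpleS] pi1 ip1; split.
  move=> /is_zeroP X0; apply/S_neq0/is_zeroP.
  by rewrite -pi1 -[i]compose1m X0 lcomp0m lcompm0.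
move=> Y j j_mono; have [|Y0|[q [qj jq]]] := simpleS Y (p ∘ j); [|by left|right].
  move=> Z a b; rewrite -!composeA => /(congr1 (compose i)).
  by rewrite !composeA ip1 !compose1m; exact: j_mono.
exists (q ∘ p); rewrite -composeA; split=> //.
by rewrite -[LHS]compose1m -ip1 -composeA (composeA p) (composeA (p ∘ j)) jq compose1m.
Qed.

End Linear.

(** Let v be an eigenvector, with eigenvalue a, of composition with f on the
    endomorphisms of X.  Then f - a id kills v, so it is not invertible and
    vanishes by Schur's lemma. *)
Lemma simple_endo_scalar (k : closedFieldType) (C : linear_category k) (X : C)
    (f : Mor X X) :
  has_kernels C -> simple_object X -> exists a : k, f = a *: (idm X : lmor X X).
Proof.
move=> kernels simpleX; have [/is_zeroP/eqP X_neq0 _] := simpleX.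
pose l (g : lmor X X) : lmor X X := f ∘ (g : Mor X X).
have l_linear : linear l by move=> a g g'; rewrite /l lcompmZD.
pose L : {linear lmor X X -> lmor X X} :=
  HB.pack l (GRing.isLinear.Build _ _ _ _ _ l_linear).
have [a [v v_neq0]] := closed_eigenvector (linfun L) X_neq0.
rewrite lfunE => fvL; exists a.
have fv : f ∘ (v : Mor X X) = a *: v :> lmor X X := fvL.
have [//|/eqP fa_neq0] := eqVneq (f : lmor X X) (a *: idm X).
pose fa : Mor X X := (- a) *: (idm X : lmor X X) + (f : lmor X X).
have [|g [gf _]] := @schur _ _ kernels _ _ fa simpleX simpleX.
  by move=> /eqP; rewrite /fa scaleNr addrC subr_eq0 => /eqP.
case/eqP: v_neq0; rewrite -[v](compose1m (c := C)) -gf -composeA /fa lcompZDm.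
by rewrite compose1m fv scaleNr addNr lcompm0.
Qed.

(** * Multiring categories *)

Section Multiring.
Variables (k : fieldType) (C : multiring_category k).

Lemma tens0m (X X' Y Y' : C) (g : Mor Y Y') :
  tensm C ((0 : lmor X X') : Mor X X') g = 0 :> lmor _ _.
Proof.
have := mr_bilinearl (-1) (0 : lmor X X') 0 g.
by rewrite scaler0 addr0 scaleN1r addNr.
Qed.

Lemma tensm0 (X X' Y Y' : C) (f : Mor X X') :
  tensm C f ((0 : lmor Y Y') : Mor Y Y') = 0 :> lmor _ _.
Proof.
have := mr_bilinearr (-1) f (0 : lmor Y Y') 0.
by rewrite scaler0 addr0 scaleN1r addNr.
Qed.

(** Every X is a retract of X ⊗ 1, which vanishes if 1 does. *)
Lemma munit_neq0 : nonzero_category C -> ~ is_zero (munit C).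
Proof.
move=> [X X_neq0] /is_zeroP unit0; apply/X_neq0/is_zeroP.
rewrite -(runitiK C X) -[runiti C X]compose1m -tensm1 unit0.
by rewrite tensm0 lcomp0m lcompm0.
Qed.

Lemma alg_unit_neq0 (A : algebra C) : ~ is_zero A -> nonzero_mor (alg_unit A).
Proof.
move=> A_neq0 u0; apply/A_neq0/is_zeroP.
by rewrite -(lunitiK C A) -alg_mul1m u0 tens0m lcompm0 lcomp0m.
Qed.

Lemma coalg_counit_neq0 (D : coalgebra C) :
  ~ is_zero D -> nonzero_mor (coalg_counit D).
Proof.
move=> D_neq0 e0; apply/D_neq0/is_zeroP.
by rewrite -(coalg_counitl D) e0 tens0m lcompm0 lcomp0m.
Qed.

Lemma mr_has_kernels : has_kernels C.
Proof. by case: (mr_abelian C). Qed.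

Section SimpleUnit.
Hypotheses (C_semisimple : semisimple_category C)
  (unit_simple : simple_object (munit C)).

Lemma alg_unit_split (A : algebra C) : ~ is_zero A -> split_mono (alg_unit A).
Proof.
move=> A_neq0; apply: nonzero_from_simple_split => //; first exact: mr_has_kernels.
exact: alg_unit_neq0.
Qed.

Lemma coalg_counit_split (D : coalgebra C) :
  ~ is_zero D -> split_epi (coalg_counit D).
Proof.
move=> D_neq0; apply: nonzero_to_simple_split => //; first exact: mr_has_kernels.
exact: coalg_counit_neq0.
Qed.

Lemma free_module_separable (A : algebra C) :
  ~ is_zero A -> separable_functor (free_module_functor A).
Proof. by move=> A_neq0; apply/split_unit_separable/alg_unit_split. Qed.

Lemma free_comodule_separable (D : coalgebra C) :
  ~ is_zero D -> separable_functor (free_comodule_functor D).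
Proof. by move=> D_neq0; apply/split_counit_separable/coalg_counit_split. Qed.

End SimpleUnit.

(** The idempotent i ∘ p is a scalar a, and p = p ∘ i ∘ p = a p with p nonzero
    gives a = 1. *)
Lemma ring_category_retract (S : C) (i : Mor S (munit C)) (p : Mor (munit C) S) :
  is_ring_category C -> ~ is_zero S -> p ∘ i = idm S -> i ∘ p = idm (munit C).
Proof.
move=> [scalar _ scalarK] S_neq0 pi1.
have [a ip_a] : exists a : k, i ∘ p = a *: (idm (munit C) : lmor _ _).
  by exists (scalar (i ∘ p)); rewrite scalarK.
have pip : p = a *: (p : lmor _ _) :> lmor _ _.
  by rewrite -[LHS]compose1m -pi1 -composeA ip_a lcompmZ composem1.
have [a1|a_neq1] := eqVneq a 1; first by rewrite ip_a a1 scale1r.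
case: S_neq0; apply/is_zeroP; rewrite -pi1.
suff -> : p = 0 :> lmor _ _ by rewrite lcomp0m.
apply/eqP; have /eqP := pip; rewrite -subr_eq0 -{1}[p : lmor _ _]scale1r -scalerBl.
by rewrite scaler_eq0 subr_eq0 eq_sym (negPf a_neq1).
Qed.

End Multiring.

Lemma simple_unit_ring_category (k : closedFieldType) (C : multiring_category k) :
  simple_object (munit C) -> is_ring_category C.
Proof.
move=> unit_simple; have [/is_zeroP/eqP unit_neq0 _] := unit_simple.
have scalarP (f : lmor (munit C) (munit C)) :
    exists a : k, a *: (idm (munit C) : lmor _ _) == f.
  have [a ->] := simple_endo_scalar (f : Mor (munit C) (munit C)) (@mr_has_kernels _ C) unit_simple.
  by exists a.
exists (fun f => xchoose (scalarP f)) => [a|f]; last exact/eqP/(xchooseP (scalarP f)).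
apply/eqP; have := xchooseP (scalarP (a *: (idm (munit C) : lmor _ _))).
by rewrite -subr_eq0 -scalerBl scaler_eq0 subr_eq0 (negPf unit_neq0) orbF.
Qed.

(** * The equivalences *)

Theorem proposition4p3 (k : closedFieldType) (C : multiring_category k)
    (C_strict : strict_monoidal C) (C_nonzero : nonzero_category C)
    (C_semisimple : semisimple_category C) (C_duals : left_duals C) :
  (simple_object (munit C) <-> is_ring_category C) /\
  [<-> (* 1 *)  simple_object (munit C);
       (* 2 *)  forall A : algebra C, ~ is_zero A -> separable_functor (free_module_functor A);
       (* 3 *)  forall D : coalgebra C, ~ is_zero D -> separable_functor (free_comodule_functor D);
       (* 4 *)  forall A : algebra C, ~ is_zero A -> faithful_functor (free_module_functor A);
       (* 5 *)  forall D : coalgebra C, ~ is_zero D -> faithful_functor (free_comodule_functor D);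
       (* 6 *)  forall A : algebra C, ~ is_zero A -> maschke_functor (free_module_functor A);
       (* 7 *)  forall D : coalgebra C, ~ is_zero D -> maschke_functor (free_comodule_functor D);
       (* 8 *)  forall A : algebra C, ~ is_zero A -> dual_maschke_functor (free_module_functor A);
       (* 9 *)  forall D : coalgebra C, ~ is_zero D -> dual_maschke_functor (free_comodule_functor D);
       (* 10 *) forall A : algebra C, ~ is_zero A -> conservative_functor (free_module_functor A);
       (* 11 *) forall D : coalgebra C, ~ is_zero D -> conservative_functor (free_comodule_functor D);
       (* 12 *) forall A : algebra C, ~ is_zero A -> monomorphism (alg_unit A);
       (* 13 *) forall D : coalgebra C, ~ is_zero D -> epimorphism (coalg_counit D);
       (* 14 *) forall (A : algebra C) (f : Mor (unit_algebra C) A),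
                  is_alg_morphism f -> nonzero_mor f -> monomorphism f;
       (* 15 *) forall (D : coalgebra C) (f : Mor D (unit_coalgebra C)),
                  is_coalg_morphism f -> nonzero_mor f -> epimorphism f].
Proof.
have unit_neq0 := munit_neq0 C_nonzero.
have [S [i [p [S_simple pi1]]]] := simple_retract C_semisimple unit_neq0.
have S_neq0 : ~ is_zero S by case: S_simple.
have unit_simple : i ∘ p = idm (munit C) -> simple_object (munit C).
  exact: simple_of_iso S_simple pi1.
split.
  split; first exact: simple_unit_ring_category.
  by move=> ringC; apply/unit_simple/ring_category_retract.
pose A := retract_algebra pi1; pose D := retract_coalgebra pi1.
have FA := free_module_retract pi1; have FD := free_comodule_retract pi1.
have sepA := free_module_separable C_semisimple.
have sepD := free_comodule_separable C_semisimple.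
(* Each property P is applied to A or D only to see that 1 is simple; the next
   property then follows from the simplicity of 1. *)
tfae=> [|P|P|P|P|P|P|P|P|P|P|P|P|P|P].
- by move=> P A' /(sepA P).
- by move=> D' /sepD; apply; apply/unit_simple/(retract_id_of_separable FA)/(P A).
- move=> A' /sepA sep; apply/separable_faithful/sep.
  exact/unit_simple/(retract_id_of_separable FD)/(P D).
- move=> D' /sepD sep; apply/separable_faithful/sep.
  exact/unit_simple/(retract_id_of_faithful FA)/(P A).
- move=> A' /sepA sep; apply/separable_maschke/sep.
  exact/unit_simple/(retract_id_of_faithful FD)/(P D).
- move=> D' /sepD sep; apply/separable_maschke/sep.
  exact/unit_simple/(retract_id_of_maschke pi1 FA)/(P A).
- move=> A' /sepA sep; apply/separable_dual_maschke/sep.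
  exact/unit_simple/(retract_id_of_maschke pi1 FD)/(P D).
- move=> D' /sepD sep; apply/separable_dual_maschke/sep.
  exact/unit_simple/(retract_id_of_dual_maschke pi1 FA)/(P A).
- move=> A' /sepA sep; apply/separable_conservative/sep.
  exact/unit_simple/(retract_id_of_dual_maschke pi1 FD)/(P D).
- move=> D' /sepD sep; apply/separable_conservative/sep.
  exact/unit_simple/(retract_id_of_conservative pi1 FA)/(P A).
- move=> A' A'_neq0; apply/split_mono_mono/alg_unit_split => //.
  exact/unit_simple/(retract_id_of_conservative pi1 FD)/(P D).
- move=> D' D'_neq0; apply/split_epi_epi/coalg_counit_split => //.
  exact/unit_simple/(retract_id_of_mono pi1)/(P A).
- move=> A' f _ f_neq0; apply/split_mono_mono.
  apply: (nonzero_from_simple_split (@mr_has_kernels _ C)) f_neq0 => //.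
  exact/unit_simple/(retract_id_of_epi pi1)/(P D).
- move=> D' f _ f_neq0; apply/split_epi_epi.
  apply: (nonzero_to_simple_split (@mr_has_kernels _ C)) f_neq0 => //.
  apply/unit_simple/(retract_id_of_mono pi1)/(P A); first exact: alg_unit_is_alg_morphism.
  exact: (@alg_unit_neq0 _ C A).
- apply/unit_simple/(retract_id_of_epi pi1)/(P D); first exact: coalg_counit_is_coalg_morphism.
  exact: (@coalg_counit_neq0 _ C D).
Qed.
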